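(* Let $d\ge 1$. There is an absolutely continuous (with respect to the Lebesgue measure on $\mathbb{R}_+^{d+1}$) measure invariant under the slow Triangle algorithm $F$ in dimension $d$, with density $h_{\mathrm{Tr}}:\mathbb{R}_+^{d+1}\to\mathbb{R}_+$, $$h_{\mathrm{Tr}}(\mathbf{x})=\frac{1}{x_0x_1\cdots x_d},$$ and there is an absolutely continuous (with respect to the Lebesgue measure on $\mathbb{R}_+^{d+1}$) measure invariant under the accelerated Triangle algorithm $F_{\mathrm{acc}}$ in dimension $d$, with density $h_{\mathrm{Tr}_{\mathrm{acc}}}:\mathbb{R}_+^{d+1}\to\mathbb{R}_+$, $$h_{\mathrm{Tr}_{\mathrm{acc}}}(\mathbf{x})=\frac{1}{(x_{\sigma_0}+x_{\sigma_d})\,x_{\sigma_0}x_{\sigma_1}\cdots x_{\sigma_{d-1}}}\qquad\text{for }\mathbf{x}\in\Lambda^{d+1}_\sigma,$$ for every permutation $\sigma$ of $\{0,\dots,d\}$.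
   Context: Notation: $\mathbb{R}_+$ is the set of positive reals. For a permutation $\sigma=(\sigma_0,\dots,\sigma_d)$ of $\{0,\dots,d\}$ let $\Lambda^{d+1}_\sigma=\{\mathbf{x}\in\mathbb{R}_+^{d+1}: x_{\sigma_0}>x_{\sigma_1}>\dots>x_{\sigma_d}\}$; these sets partition $\mathbb{R}_+^{d+1}$ up to measure zero. All maps and densities are defined up to sets of Lebesgue measure zero. The slow linear Triangle algorithm is the map $F:\mathbb{R}_+^{d+1}\to\mathbb{R}_+^{d+1}$ which, for $\mathbf{x}\in\Lambda^{d+1}_\sigma$, leaves all coordinates other than $x_{\sigma_0}$ unchanged and replaces $x_{\sigma_0}$ by $x_{\sigma_0}-x_{\sigma_1}$ if $x_{\sigma_0}<x_{\sigma_1}+x_{\sigma_d}$, and by $x_{\sigma_0}-x_{\sigma_d}$ otherwise. The accelerated linear Triangle algorithm is the map $F_{\mathrm{acc}}:\mathbb{R}_+^{d+1}\to\mathbb{R}_+^{d+1}$ which, for $\mathbf{x}\in\Lambda^{d+1}_\sigma$, leaves all coordinates other than $x_{\sigma_0}$ unchanged and replaces $x_{\sigma_0}$ by $x_{\sigma_0}-x_{\sigma_1}-kx_{\sigma_d}$, where $k\ge0$ is the integer such that $x_{\sigma_1}+kx_{\sigma_d}<x_{\sigma_0}<x_{\sigma_1}+(k+1)x_{\sigma_d}$. A (possibly infinite) measure $\mu$ is invariant under a map $S$ if $\mu(S^{-1}(X))=\mu(X)$ for all measurable $X$. *)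

(* Defs.v *)
From HB Require Import structures.
From mathcomp Require Import all_boot all_order all_algebra perm.
From mathcomp Require Import all_classical all_reals all_analysis.
Set Implicit Arguments.
Unset Strict Implicit.
Unset Printing Implicit Defensive.
Import Order.TTheory GRing.Theory Num.Theory.
Import numFieldNormedType.Exports.
Local Open Scope classical_set_scope.
Local Open Scope ring_scope.

(* R^n is [n.-tuple R], whose library sigma-algebra is the product of the Borel
   sigma-algebras.  Lebesgue measure on R^n is built by transporting
   [lebesgue_measure \x lebesgue_tuple n] along (a, t) |-> a :: t;
   [lebesgue_tuple_box] characterizes it. *)

Section lebesgue_tuple.
Context (R : realType).

Definition tuple_cons n (p : measurableTypeR R * n.-tuple R) : n.+1.-tuple R :=
  [tuple of p.1 :: p.2].

Lemma measurable_tuple_cons n : measurable_fun setT (@tuple_cons n).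
Proof. by apply: (@measurable_cons _ _ _ R); [exact: measurable_fst|exact: measurable_snd]. Qed.

Lemma measurable_tuple_uncons n :
  measurable_fun setT
    (fun t : n.+1.-tuple R =>
       ((thead t : measurableTypeR R), [tuple of behead t])).
Proof.
apply/measurable_fun_pair; first exact: measurable_tnth.
exact: measurable_behead.
Qed.

Section step.
Context n (m : {sigma_finite_measure set (n.-tuple R) -> \bar R}).

Definition lebesgue_tuple_step :=
  pushforward (@lebesgue_measure R \x m)%E (@tuple_cons n).

Let step0 : lebesgue_tuple_step set0 = 0%E.
Proof. by rewrite /lebesgue_tuple_step /pushforward preimage_set0 measure0. Qed.

Let step_ge0 A : (0 <= lebesgue_tuple_step A)%E.
Proof. by rewrite /lebesgue_tuple_step /pushforward measure_ge0. Qed.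

Let step_sigma_additive : semi_sigma_additive lebesgue_tuple_step.
Proof.
exact: (@measure_semi_sigma_additive _ _ _
  (measure_function_pushforward__canonical__measure_function_Measure
    (@lebesgue_measure R \x m)%E (@measurable_tuple_cons n))).
Qed.

HB.instance Definition _ := isMeasure.Build _ _ _ lebesgue_tuple_step
  step0 step_ge0 step_sigma_additive.

Lemma lebesgue_tuple_step_sigma_finite : sigma_finite setT lebesgue_tuple_step.
Proof.
have [F FT Foo] : sigma_finite setT (@lebesgue_measure R \x m)%E.
  have /sigma_finiteP[F [TF ndF Foo]] := sigma_finiteT (@lebesgue_measure R).
  have /sigma_finiteP[G [TG ndG Goo]] := sigma_finiteT m.
  exists (fun k => F k `*` G k).
    rewrite -setXTT TF TG predeqE => -[x y]; split.
      move=> [/= [j _ Fjx] [k _ Gky]]; exists (maxn j k) => //; split.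
      - by move: x Fjx; exact/subsetPset/ndF/leq_maxl.
      - by move: y Gky; exact/subsetPset/ndG/leq_maxr.
    by move=> [j _ []/= ? ?]; split; exists j.
  move=> k; have [? ?] := Foo k; have [? ?] := Goo k.
  split; first exact: measurableX.
  by rewrite product_measure1E// lte_mul_pinfty// ge0_fin_numE.
pose u (t : n.+1.-tuple R) := ((thead t : measurableTypeR R), [tuple of behead t]).
have uK : cancel (@tuple_cons n) u.
  by case=> x t; rewrite /u /tuple_cons/=; congr pair; apply: val_inj.
exists (fun k => u @^-1` F k).
  by rewrite -preimage_bigcup -FT preimage_setT.
move=> k; have [mF Fk] := Foo k; split.
  by rewrite -[X in measurable X]setTI; exact: measurable_tuple_uncons.
rewrite /lebesgue_tuple_step /pushforward.
rewrite (_ : _ @^-1` _ = F k)//.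
by apply/seteqP; split => p /=; rewrite uK.
Qed.

HB.instance Definition _ := @Measure_isSigmaFinite.Build _ _ _
  lebesgue_tuple_step lebesgue_tuple_step_sigma_finite.

End step.

Fixpoint lebesgue_tuple n : {sigma_finite_measure set (n.-tuple R) -> \bar R} :=
  if n is n'.+1 then lebesgue_tuple_step (lebesgue_tuple n')
  else dirac ([tuple] : 0.-tuple R).

Lemma lebesgue_tuple_box n (A : 'I_n -> set R) :
  (forall i, measurable (A i)) ->
  lebesgue_tuple n [set t | forall i, A i (tnth t i)] =
  (\prod_(i < n) lebesgue_measure (A i))%E.
Proof.
elim: n A => [|n IH] A mA /=.
  rewrite big_ord0 diracE mem_set//; by case.
rewrite /lebesgue_tuple_step /pushforward.
have mB : measurable [set t : n.-tuple R | forall i, A (lift ord0 i) (tnth t i)].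
  rewrite (_ : [set _ | _] =
      \bigcap_(i in [set: 'I_n])
        ((fun t : n.-tuple R => tnth t i) @^-1` A (lift ord0 i))).
    apply: fin_bigcap_measurable => // i _.
    rewrite -[X in measurable X]setTI.
    by apply: measurable_tnth => //.
  by apply/seteqP; split => t /= h i; [move=> _|]; exact: h.
rewrite (_ : _ @^-1` _ =
    A ord0 `*` [set t : n.-tuple R | forall i, A (lift ord0 i) (tnth t i)]).
  rewrite product_measure1E; [|exact: mA|exact: mB].
  rewrite big_ord_recl; congr (_ * _)%E.
  by apply: (IH (fun i => A (lift ord0 i))) => i; exact: mA.
apply/seteqP; split => -[x t]/=.
  move=> h; split; first exact: (h ord0).
  by move=> i; have := h (lift ord0 i); rewrite /tuple_cons tnthS.
move=> [h0 h] i; case: (unliftP ord0 i) => [j ->|->]//.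
by rewrite /tuple_cons tnthS.
Qed.

End lebesgue_tuple.

Section measures.
Context (R : realType).

Definition orthant n : set (n.-tuple R) := [set x | forall i, 0 < tnth x i].

(* A Borel measure on [D] is represented by a Borel measure on R^n that is
   carried by [D]. *)
Definition has_density n (D : set (n.-tuple R)) (h : n.-tuple R -> R)
    (mu : set (n.-tuple R) -> \bar R) :=
  [/\ measurable_fun D h,
      forall x, D x -> 0 < h x &
      forall A, measurable A ->
        mu A = (\int[lebesgue_tuple R n]_(x in A `&` D) (h x)%:E)%E].

(* [S] is a measurable map from [D] to [D]; its values outside [D] are
   irrelevant. *)
Definition invariant_under d (T : measurableType d) (D : set T) (S : T -> T)
    (mu : set T -> \bar R) :=
  [/\ set_fun D D S,
      measurable_fun D S &
      forall X, measurable X -> X `<=` D -> mu (D `&` S @^-1` X) = mu X].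

End measures.

Section triangle.
Context (R : realType) (d : nat).
Implicit Types (s : {perm 'I_d.+1}) (x : d.+1.-tuple R).

Definition in_chamber s x : bool :=
  [forall i, 0 < tnth x i] &&
  [forall i : 'I_d.+1, forall j : 'I_d.+1,
     (i < j)%N ==> (tnth x (s j) < tnth x (s i))].

Definition chamber s : set (d.+1.-tuple R) := [set x | in_chamber s x].

Definition set_coord x (i : 'I_d.+1) (a : R) : d.+1.-tuple R :=
  [tuple if j == i then a else tnth x j | j < d.+1].

(* [inord 1] is the index 1 as soon as [0 < d]. *)
Definition slow_step s x : R :=
  let x0 := tnth x (s ord0) in
  let x1 := tnth x (s (inord 1)) in
  let xd := tnth x (s ord_max) in
  if x0 < x1 + xd then x0 - x1 else x0 - xd.

(* Where no such integer k exists (a null set), k = 0 is used. *)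
Definition acc_step s x : R :=
  let x0 := tnth x (s ord0) in
  let x1 := tnth x (s (inord 1)) in
  let xd := tnth x (s ord_max) in
  let k := xget 0%N
    [set k : nat | x1 + k%:R * xd < x0 < x1 + k.+1%:R * xd] in
  x0 - x1 - k%:R * xd.

(* The chambers cover the orthant up to a null set, where (as outside the
   orthant) the maps are completed by the identity.  The permutation picked is
   the only possible one, see [chamber_inj]. *)
Definition slow_triangle x : d.+1.-tuple R :=
  if [pick s | in_chamber s x] is Some s
  then set_coord x (s ord0) (slow_step s x) else x.

Definition acc_triangle x : d.+1.-tuple R :=
  if [pick s | in_chamber s x] is Some s
  then set_coord x (s ord0) (acc_step s x) else x.

Lemma chamber_inj s s' x : chamber s x -> chamber s' x -> s = s'.
Proof.
rewrite /chamber/= => /andP[_ /forallP sx] /andP[_ /forallP s'x].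
pose f (u : {perm 'I_d.+1}) i := tnth x (u i).
have mono (u : {perm 'I_d.+1}) : (forall i : 'I_d.+1, [forall j : 'I_d.+1,
    (i < j)%N ==> (tnth x (u j) < tnth x (u i))]) ->
    sorted >%R [seq f u i | i <- enum 'I_d.+1].
  move=> h; rewrite sorted_map.
  apply: (@sub_sorted _ (fun i j : 'I_d.+1 => (i < j)%N)).
    by move=> i j ij; move/forallP: (h i) => /(_ j) /implyP; exact.
  by rewrite -(@sorted_map _ _ val ltn) val_enum_ord iota_ltn_sorted.
have perm (u : {perm 'I_d.+1}) : perm_eq [seq u i | i <- enum 'I_d.+1] (enum 'I_d.+1).
  apply: uniq_perm; rewrite ?enum_uniq//.
    by rewrite map_inj_uniq ?enum_uniq//; exact: perm_inj.
  by move=> i; rewrite mem_enum -[i](permKV u) map_f// mem_enum.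
have eqs : [seq f s i | i <- enum 'I_d.+1] = [seq f s' i | i <- enum 'I_d.+1].
  apply: (@irr_sorted_eq _ >%R).
  - by move=> a b c ba cb /=; exact: lt_trans cb ba.
  - by move=> a /=; rewrite ltxx.
  - exact: mono.
  - exact: mono.
  - move=> a; have hu (u : {perm 'I_d.+1}) : [seq f u i | i <- enum 'I_d.+1] =i
        [seq tnth x i | i <- enum 'I_d.+1].
      move=> b; rewrite (map_comp (tnth x) u).
      by apply: perm_mem; apply: perm_map; exact: perm.
    by rewrite !hu.
apply/permP => i.
have fs : f s i = f s' i.
  by move/eq_in_map: eqs; apply; rewrite mem_enum.
have inj j k : j != k -> tnth x (s j) != tnth x (s k).
  rewrite neq_ltn => /orP[jk|kj].
    by move/forallP: (sx j) => /(_ k)/implyP/(_ jk) h; rewrite gt_eqF.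
  by move/forallP: (sx k) => /(_ j)/implyP/(_ kj) h; rewrite lt_eqF.
rewrite -(permKV s (s' i)); congr (s _); apply/eqP; apply/negPn/negP => /inj.
by rewrite permKV; move: fs; rewrite /f => ->; rewrite eqxx.
Qed.

Lemma slow_triangleE s x :
  chamber s x -> slow_triangle x = set_coord x (s ord0) (slow_step s x).
Proof.
move=> sx; rewrite /slow_triangle; case: pickP => [s' s'x|/(_ s)].
  by rewrite (chamber_inj sx s'x).
by rewrite (sx : in_chamber s x).
Qed.

Lemma acc_triangleE s x :
  chamber s x -> acc_triangle x = set_coord x (s ord0) (acc_step s x).
Proof.
move=> sx; rewrite /acc_triangle; case: pickP => [s' s'x|/(_ s)].
  by rewrite (chamber_inj sx s'x).
by rewrite (sx : in_chamber s x).
Qed.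

End triangle.

(* Main.v *)
Require Import Defs.
From HB Require Import structures.
From mathcomp Require Import all_boot all_order all_algebra perm.
From mathcomp Require Import all_classical all_reals all_analysis.
From mathcomp Require Import measurable_realfun ring.
Import Order.TTheory GRing.Theory Num.Theory.
Import numFieldNormedType.Exports.
Local Open Scope classical_set_scope.
Local Open Scope ring_scope.
Set Implicit Arguments.
Unset Strict Implicit.
Unset Printing Implicit Defensive.

(* Write M_j and m_j for the maximum and the minimum of the coordinates other
   than x_j.  Up to null sets both maps are made of countably many branches of
   the form x_j |-> x_j - phi(x), where phi does not depend on x_j: M_j and m_j
   for the slow map, M_j + k m_j for the accelerated one.  Such shears preserve
   Lebesgue measure, so h is an invariant density as soon as the sum of h over
   the preimages of y is h(y).  If y_a is the smallest and y_b the largest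
   coordinate of y, the preimages under the slow map are obtained by replacing
   y_a or y_b by y_a + y_b, and 1/(y_b (y_a + y_b)) + 1/(y_a (y_a + y_b)) =
   1/(y_a y_b).  Under the accelerated map they are obtained by replacing y_a by
   t_k = y_a + y_b + k m_a for k >= 0; as m_a/(t_k (t_k + m_a)) =
   1/t_k - 1/t_{k+1}, the sum telescopes to its first term 1/(y_a + y_b). *)

(** * Shears preserve Lebesgue measure *)

Section shear.
Context (R : realType).

(** Change of variables: the left side is an integral against the pushforward of [mu] by [phi], and
    that pushforward agrees with [nu] on measurable sets. *)
Lemma ge0_integral_comp d1 d2 (X : measurableType d1) (Y : measurableType d2)
    (mu : {measure set X -> \bar R}) (nu : {measure set Y -> \bar R})
    (phi : X -> Y) (f : Y -> \bar R) :
  measurable_fun setT phi ->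
  (forall A, measurable A -> mu (phi @^-1` A) = nu A) ->
  measurable_fun setT f -> (forall y, 0 <= f y)%E ->
  (\int[mu]_x f (phi x) = \int[nu]_y f y)%E.
Proof.
move=> mphi munu mf f0.
rewrite -[LHS](ge0_integral_pushforward mphi mu measurableT mf)//.
pose m := measure_function_pushforward__canonical__measure_function_Measure
  mu mphi.
by apply: (@eq_measure_integral _ _ _ _ nu m) => A mA _; exact: munu.
Qed.

Lemma measurable_addr_cst (c : R) :
  measurable_fun [set: measurableTypeR R]
    ((fun x => x + c) : measurableTypeR R -> measurableTypeR R).
Proof. exact: (measurable_funD (@measurable_id _ _ _) (measurable_cst c)). Qed.

(** By uniqueness of Lebesgue measure it is enough to compare with the pushforward under the
    translation on the intervals []a, b]]. *)
Lemma lebesgue_measure_addr (c : R) (A : set (measurableTypeR R)) :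
  measurable A ->
  lebesgue_measure ((fun x => x + c) @^-1` A) = lebesgue_measure A.
Proof.
move=> mA; pose m := pushforward (@lebesgue_measure R)
  ((fun x => x + c) : measurableTypeR R -> measurableTypeR R).
apply/esym.
apply: (@lebesgue_measure_unique R
  (measure_function_pushforward__canonical__measure_function_Measure
    (@lebesgue_measure R) (measurable_addr_cst c))) => //.
move=> _ [[a b] _ <-] /=; rewrite /pushforward /=.
rewrite (_ : _ @^-1` _ = `]a - c, b - c]%classic).
  by rewrite !lebesgue_measure_itv/= !lte_fin ltrD2r -!EFinD opprB addrA subrK.
by apply/seteqP; split => x /=; rewrite !in_itv/= ltrBlDr lerBrDr.
Qed.

Lemma ge0_integral_addr (c : R) (f : measurableTypeR R -> \bar R) :
  measurable_fun setT f -> (forall x, 0 <= f x)%E ->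
  (\int[lebesgue_measure]_x f (x + c)%R = \int[lebesgue_measure]_x f x)%E.
Proof.
move=> mf f0.
apply: (@ge0_integral_comp _ _ (measurableTypeR R) (measurableTypeR R)
  lebesgue_measure lebesgue_measure (fun x => x + c) f) => //.
  exact: measurable_addr_cst.
exact: lebesgue_measure_addr.
Qed.

(** Immediate from the construction of [lebesgue_tuple] as a pushforward of a product; it gives
    access to Tonelli's theorem. *)
Lemma ge0_integral_lebesgue_tupleS n (f : n.+1.-tuple R -> \bar R) :
  measurable_fun setT f -> (forall x, 0 <= f x)%E ->
  (\int[lebesgue_tuple R n.+1]_x f x =
   \int[@lebesgue_measure R \x lebesgue_tuple R n]_p f (tuple_cons p))%E.
Proof.
move=> mf f0.
apply/esym; apply: (@ge0_integral_comp _ _ _ _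
  (lebesgue_measure \x lebesgue_tuple R n)%E (lebesgue_tuple R n.+1)
  (@tuple_cons R n) f) => //.
exact: measurable_tuple_cons.
Qed.

Lemma set_coord_cons n (a b : R) (t : n.+1.-tuple R) (j : 'I_n.+1) :
  set_coord [tuple of a :: t] (lift ord0 j) b = [tuple of a :: set_coord t j b].
Proof.
apply: eq_from_tnth => i; rewrite /set_coord tnth_mktuple.
case: (unliftP ord0 i) => [k ->|->]; last by rewrite !tnth0 (negbTE (neq_lift _ _)).
by rewrite !tnthS tnth_mktuple (inj_eq lift_inj).
Qed.

Lemma set_coord_cons0 n (a b : R) (t : n.-tuple R) :
  set_coord [tuple of a :: t] ord0 b = [tuple of b :: t].
Proof.
apply: eq_from_tnth => i; rewrite /set_coord tnth_mktuple.
case: (unliftP ord0 i) => [k ->|->]; last by rewrite !tnth0.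
by rewrite !tnthS eq_sym (negbTE (neq_lift _ _)).
Qed.

Lemma measurable_set_coord n (j : 'I_n.+1) (phi : n.+1.-tuple R -> R) :
  measurable_fun setT phi ->
  measurable_fun setT (fun x => set_coord x j (phi x)).
Proof.
move=> mphi; apply/measurable_fun_tnthP => i.
rewrite (_ : _ \o _ = fun x => if i == j then phi x else tnth x i); last first.
  by apply/funext => x /=; rewrite /set_coord tnth_mktuple.
by case: eqP => // _; exact: measurable_tnth.
Qed.

Lemma measurable_shear n (j : 'I_n.+1) (phi : n.+1.-tuple R -> R) :
  measurable_fun setT phi ->
  measurable_fun setT (fun x => set_coord x j (tnth x j + phi x)).
Proof.
move=> mphi; apply: measurable_set_coord; apply: measurable_funD => //.
exact: measurable_tnth.
Qed.

(** By Tonelli the moved coordinate can be integrated first. With the tail fixed, [phi] is a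
    constant and the shear is a translation of the line. *)
Lemma ge0_integral_shear0 n (phi : n.+1.-tuple R -> R)
    (f : n.+1.-tuple R -> \bar R) :
  measurable_fun setT phi ->
  (forall x a, phi (set_coord x ord0 a) = phi x) ->
  measurable_fun setT f -> (forall x, 0 <= f x)%E ->
  (\int[lebesgue_tuple R n.+1]_x f (set_coord x ord0 (tnth x ord0 + phi x)%R) =
   \int[lebesgue_tuple R n.+1]_x f x)%E.
Proof.
move=> mphi phij mf f0.
pose g x := f (set_coord x ord0 (tnth x ord0 + phi x)).
have mg : measurable_fun setT g by apply: measurableT_comp (measurable_shear _ _).
have g0 x : (0 <= g x)%E by exact: f0.
rewrite (ge0_integral_lebesgue_tupleS mg g0) (ge0_integral_lebesgue_tupleS mf f0).
have mgc := measurableT_comp mg (@measurable_tuple_cons R n).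
have mfc := measurableT_comp mf (@measurable_tuple_cons R n).
rewrite (fubini_tonelli2 (g \o @tuple_cons R n) mgc (fun=> g0 _)).
rewrite (fubini_tonelli2 (f \o @tuple_cons R n) mfc (fun=> f0 _)).
apply: eq_integral => t _; rewrite /fubini_G/=.
(* The head 0 is arbitrary, since [phi] ignores coordinate 0. *)
pose c := phi (tuple_cons (0, t)).
rewrite -(@ge0_integral_addr c (fun a => f (tuple_cons (a, t))))//; last first.
  exact: measurableT_comp mfc (measurable_pair2 _).
apply: eq_integral => a _; rewrite /g /tuple_cons/= set_coord_cons0 tnth0.
by rewrite -(phij _ 0) set_coord_cons0.
Qed.

(** Induction on the dimension. If the moved coordinate is not the first, Tonelli freezes the first
    one at [a], and what remains is a shear of the tail with displacement [phi (a :: t)]. *)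
Lemma ge0_integral_shear n (j : 'I_n.+1) (phi : n.+1.-tuple R -> R)
    (f : n.+1.-tuple R -> \bar R) :
  measurable_fun setT phi ->
  (forall x a, phi (set_coord x j a) = phi x) ->
  measurable_fun setT f -> (forall x, 0 <= f x)%E ->
  (\int[lebesgue_tuple R n.+1]_x f (set_coord x j (tnth x j + phi x)%R) =
   \int[lebesgue_tuple R n.+1]_x f x)%E.
Proof.
elim: n j phi f => [|n IH] j phi f mphi phij mf f0.
  by rewrite ord1; apply: ge0_integral_shear0 => // x a; rewrite -[ord0](ord1 j).
case: (unliftP ord0 j) phij => [k ->{j}|-> phij] ; last exact: ge0_integral_shear0.
move=> phik; pose j := lift ord0 k.
pose g x := f (set_coord x j (tnth x j + phi x)).
have mg : measurable_fun setT g by apply: measurableT_comp (measurable_shear _ _).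
have g0 x : (0 <= g x)%E by exact: f0.
rewrite (ge0_integral_lebesgue_tupleS mg g0) (ge0_integral_lebesgue_tupleS mf f0).
have mgc := measurableT_comp mg (@measurable_tuple_cons R n.+1).
have mfc := measurableT_comp mf (@measurable_tuple_cons R n.+1).
rewrite (fubini_tonelli1 (g \o @tuple_cons R n.+1) mgc (fun=> g0 _)).
rewrite (fubini_tonelli1 (f \o @tuple_cons R n.+1) mfc (fun=> f0 _)).
apply: eq_integral => a _; rewrite /fubini_F/=.
have mc : measurable_fun setT (fun t : n.+1.-tuple R => tuple_cons (a, t)).
  exact: measurableT_comp (@measurable_tuple_cons R n.+1) (measurable_pair1 _).
rewrite -(IH k (fun t => phi (tuple_cons (a, t))) (fun t => f (tuple_cons (a, t))))//.
- by apply: eq_integral => t _; rewrite /g /tuple_cons/= set_coord_cons tnthS.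
- exact: measurableT_comp mphi mc.
- by move=> t b; rewrite /tuple_cons/= -set_coord_cons phik.
- exact: measurableT_comp mf mc.
Qed.

(** The shear by [phi] carries the hyperplane where coordinate [j] vanishes to this graph, and the
    hyperplane is a box with one side reduced to a point. *)
Lemma lebesgue_tuple_graph n (j : 'I_n.+1) (phi : n.+1.-tuple R -> R) :
  measurable_fun setT phi ->
  (forall x a, phi (set_coord x j a) = phi x) ->
  (lebesgue_tuple R n.+1).-negligible [set x | tnth x j = phi x].
Proof.
move=> mphi phij.
have mE (psi : n.+1.-tuple R -> R) : measurable_fun setT psi ->
    measurable [set x | tnth x j = psi x].
  move=> mpsi; rewrite (_ : [set _ | _] = (fun x => tnth x j == psi x) @^-1` [set true]).
    rewrite -[X in measurable X]setTI; apply: measurable_fun_eqr => //.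
    exact: measurable_tnth.
  by apply/seteqP; split => x /= /eqP.
exists [set x | tnth x j = phi x]; split => //; first exact: mE.
have mP := mE _ mphi; have m0 := mE (cst 0) (measurable_cst _).
pose A := [set x : n.+1.-tuple R | tnth x j = phi x].
transitivity (\int[lebesgue_tuple R n.+1]_x (\1_A x)%:E)%E.
  by rewrite integral_indic// setIT.
rewrite -(@ge0_integral_shear n j phi) => //; last first.
  by apply/measurable_EFinP/measurable_indicP.
transitivity (\int[lebesgue_tuple R n.+1]_x
    (\1_[set x : n.+1.-tuple R | tnth x j = 0] x)%:E)%E.
  apply: eq_integral => x _; congr (_%:E); rewrite !indicE; congr (nat_of_bool _)%:R.
  apply/idP/idP; rewrite !inE /A/= phij {1}/set_coord tnth_mktuple eqxx.
    by move=> /eqP; rewrite -subr_eq0 addrK => /eqP.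
  by move=> ->; rewrite add0r.
rewrite integral_indic// setIT.
transitivity (lebesgue_tuple R n.+1
    [set t | forall i, (if i == j then [set 0] else setT) (tnth t i)]).
  congr (lebesgue_tuple R n.+1 _); apply/seteqP; split => x /=.
    by move=> xj0 i; case: eqP => // ->.
  by move=> /(_ j); rewrite eqxx.
rewrite (@lebesgue_tuple_box R n.+1
  (fun i => if i == j then [set 0] else setT)); last first.
  by move=> i; case: ifP.
by rewrite (bigD1 j)//= eqxx lebesgue_measure_set1 mul0e.
Qed.

End shear.

(** * Invariant densities of piecewise shears *)

Section invariance.
Context (R : realType).

Lemma ge0_exists_measure_density dT (T : measurableType dT)
    (m : {measure set T -> \bar R}) (f : T -> \bar R) :
  measurable_fun setT f -> (forall x, 0 <= f x)%E ->
  exists mu : {measure set T -> \bar R},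
    forall A, mu A = (\int[m]_(x in A) f x)%E.
Proof.
move=> mf f0; pose F A := (\int[m]_(x in A) f x)%E.
have F0 : F set0 = 0%E by rewrite /F integral_set0.
have Fge0 A : (0 <= F A)%E by exact: integral_ge0.
have FS : semi_sigma_additive F by exact: semi_sigma_additive_nng_induced.
pose mu : {measure set T -> \bar R} :=
  HB.pack F (isMeasure.Build _ _ _ F F0 Fge0 FS).
by exists mu.
Qed.

Lemma nneseries_pick1 (u : nat -> \bar R) k :
  (forall i, i != k -> u i = 0)%E -> (0 <= u k)%E ->
  (\sum_(0 <= i <oo) u i = u k)%E.
Proof.
move=> u0 uk; rewrite (@nneseriesD1 _ u k xpredT)//; last first.
  by move=> i _; have [->//|/u0 ->] := eqVneq i k.
by rewrite eseries0 ?adde0// => i _ /u0.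
Qed.

Lemma measurable_orthant n : measurable (@orthant R n).
Proof.
rewrite (_ : @orthant R n = \bigcap_(i in [set: 'I_n])
    ((fun x : n.-tuple R => tnth x i) @^-1` `]0, +oo[%classic)).
  apply: fin_bigcap_measurable => // i _; rewrite -[X in measurable X]setTI.
  exact: measurable_tnth.
by apply/seteqP; split => [x x0 i _|x x0 i]; have := x0 i;
  rewrite /= in_itv/= andbT//; apply.
Qed.

(* [B j k] are the domains of the branches of [S], of the form
   [x_j |-> x_j - phi j k x]; the last hypothesis is the fixed point equation of
   the transfer operator. *)
Lemma exists_shear_invariant_density n (h : n.+1.-tuple R -> R)
    (S : n.+1.-tuple R -> n.+1.-tuple R)
    (B : 'I_n.+1 -> nat -> set (n.+1.-tuple R))
    (phi : 'I_n.+1 -> nat -> n.+1.-tuple R -> R) (N : set (n.+1.-tuple R)) :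
  measurable_fun (@orthant R n.+1) h ->
  (forall x, orthant x -> 0 < h x) ->
  set_fun (@orthant R n.+1) (@orthant R n.+1) S ->
  measurable_fun (@orthant R n.+1) S ->
  (forall j k, measurable (B j k)) ->
  (forall j k, B j k `<=` @orthant R n.+1) ->
  (forall j k, measurable_fun setT (phi j k)) ->
  (forall j k x a, phi j k (set_coord x j a) = phi j k x) ->
  (lebesgue_tuple R n.+1).-negligible N ->
  (forall x, orthant x -> ~ N x -> exists j k,
    [/\ B j k x, S x = set_coord x j (tnth x j - phi j k x) &
        forall j' k', B j' k' x -> j' = j /\ k' = k]) ->
  (forall x, orthant x -> ~ N x ->
    (\sum_(j < n.+1) \sum_(0 <= k <oo)
      (let x' := set_coord x j (tnth x j + phi j k x)%R in
       (\1_(B j k) x' * h x')%:E) = (h x)%:E)%E) ->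
  exists mu : {measure set (n.+1.-tuple R) -> \bar R},
    [/\ mu `<< lebesgue_tuple R n.+1,
        has_density (@orthant R n.+1) h mu &
        invariant_under (@orthant R n.+1) S mu].
Proof.
move=> mh h0 SD mS mB BD mphi phij negN branch transfer.
set D := @orthant R n.+1; set L := lebesgue_tuple R n.+1.
have mD : measurable D by exact: measurable_orthant.
(* Extending the density by zero lets every integral run over the whole space. *)
pose w := h \_ D.
have mw : measurable_fun setT w by exact: (measurable_restrictT h mD).1.
have wD x : D x -> w x = h x by move=> Dx; rewrite /w patchE mem_set.
have wC x : ~ D x -> w x = 0 by move=> Dx; rewrite /w patchE memNset.
have w0 x : 0 <= w x.
  by have [Dx|Dx] := pselect (D x); [rewrite wD// ltW// h0|rewrite wC].
have [mu muE] : exists mu : {measure set (n.+1.-tuple R) -> \bar R},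
    forall A, mu A = (\int[L]_(x in A) (w x)%:E)%E.
  apply: ge0_exists_measure_density => [|x]; first exact/measurable_EFinP.
  by rewrite lee_fin.
exists mu; split.
- apply/null_content_dominatesP => A mA LA0; rewrite muE null_set_integral//.
  exact/measurable_funTS/measurable_EFinP.
- split => // A mA; rewrite muE integral_mkcondr; apply: eq_integral => x _.
  by rewrite /w !patchE; case: ifP.
split => // X mX XD.
(* Off [N], on the branch [(j, k)] the shear inside the last indicator is [S]; so the [F j k] split
   by branches the density restricted to the preimage of [X]. *)
pose F j k x := (w x * \1_(B j k) x *
  \1_X (set_coord x j (tnth x j - phi j k x)))%:E.
have mF j k : measurable_fun setT (F j k).
  apply/measurable_EFinP; apply: measurable_funM.
    by apply: measurable_funM => //; exact: measurable_indic.
  apply: (@measurableT_comp _ _ _ _ _ _ (\1_X : _ -> R)).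
    exact: measurable_indic.
  apply: measurable_set_coord; apply: measurable_funB => //.
  exact: measurable_tnth.
have F0 j k x : (0 <= F j k x)%E by rewrite lee_fin !mulr_ge0.
have mDS : measurable (D `&` S @^-1` X) by exact: mS.
have sum_int (G : 'I_n.+1 -> nat -> n.+1.-tuple R -> \bar R) :
    (forall j k, measurable_fun setT (G j k)) ->
    (forall j k x, 0 <= G j k x)%E ->
    measurable_fun setT (fun x => \sum_j \sum_(0 <= k <oo) G j k x)%E /\
    (\int[L]_x (\sum_j \sum_(0 <= k <oo) G j k x) =
     \sum_j \sum_(0 <= k <oo) \int[L]_x G j k x)%E.
  move=> mG G0.
  have mGj j : measurable_fun setT (fun x => \sum_(0 <= k <oo) G j k x)%E.
    by apply: ge0_emeasurable_sum => // k x _ _; exact: G0.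
  split; first exact: emeasurable_sum.
  rewrite ge0_integral_sum//; last first.
    by move=> j x _; apply: nneseries_ge0 => k _ _; exact: G0.
  by apply: eq_bigr => j _; rewrite integral_nneseries.
(* [F'] is [F] precomposed with the inverse shear: its argument is the image point, and [F] is
   evaluated at the candidate preimage. *)
pose F' j k x := F j k (set_coord x j (tnth x j + phi j k x)).
have mF' j k : measurable_fun setT (F' j k).
  exact: measurableT_comp (mF j k) (measurable_shear j (mphi j k)).
have F'0 j k x : (0 <= F' j k x)%E by exact: F0.
have [mFs intF] := sum_int F mF F0.
have [mF's intF'] := sum_int F' mF' F'0.
have sum_ge0 (G : 'I_n.+1 -> nat -> n.+1.-tuple R -> \bar R) x :
    (forall j k x, 0 <= G j k x)%E ->
    (0 <= \sum_j \sum_(0 <= k <oo) G j k x)%E.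
  by move=> G0; apply: sume_ge0 => j _; apply: nneseries_ge0 => k _ _; exact: G0.
have [M [mM M0 NM]] := negN.
rewrite !muE.
(* Off [N] a point of the orthant lies in exactly one branch, so a single term of the double sum can
   be nonzero. *)
transitivity (\int[L]_x (\sum_j \sum_(0 <= k <oo) F j k x))%E.
  rewrite integral_mkcond; apply: ge0_ae_eq_integral => //.
  - apply/(measurable_restrictT _ mDS)/measurable_funTS.
    exact/measurable_EFinP.
  - by move=> x _; rewrite patchE; case: ifP => // _; rewrite lee_fin.
  - by move=> x _; exact: sum_ge0.
  exists M; split => // x /= xM; apply: NM; apply: contrapT => Nx; apply: xM => _.
  have [Dx|Dx] := pselect (D x); last first.
    rewrite patchE memNset; last by case.
    rewrite big1// => j _; rewrite eseries0// => k _ _.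
    by rewrite /F wC// !mul0r.
  have [j [k [Bx Sx Bu]]] := branch x Dx Nx.
  rewrite (bigD1 j)//= (@nneseries_pick1 _ k)//; last first.
    move=> i /eqP ik; rewrite /F (indicE _ (B j i)) memNset ?mulr0 ?mul0r//.
    by move=> /Bu[].
  rewrite big1 ?adde0; last first.
    move=> i /eqP ij; rewrite eseries0// => l _ _.
    rewrite /F (indicE _ (B i l)) memNset ?mulr0 ?mul0r//.
    by move=> /Bu[].
  rewrite /F -Sx (indicE _ (B j k)) mem_set// mulr1 indicE patchE.
  have [XS|XS] := pselect (X (S x)).
    by rewrite (mem_set XS) mulr1 mem_set.
  by rewrite (memNset XS) mulr0 memNset// => -[].
rewrite intF.
transitivity (\sum_j \sum_(0 <= k <oo) \int[L]_x F' j k x)%E.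
  apply: eq_bigr => j _; apply: eq_eseriesr => k _.
  by rewrite /F' ge0_integral_shear.
(* Seen from the image point, the indicator of [X] factors out of the sum, and the fixed point
   equation evaluates the rest as [h]. *)
rewrite -intF' [RHS]integral_mkcond; apply: ge0_ae_eq_integral => //.
- by apply/(measurable_restrictT _ mX)/measurable_funTS; exact/measurable_EFinP.
- by move=> x _; exact: sum_ge0.
- by move=> x _; rewrite patchE; case: ifP => // _; rewrite lee_fin.
exists M; split => // x /= xM; apply: NM; apply: contrapT => Nx; apply: xM => _.
(* The branch undoes the inverse shear because [phi j k] does not see the coordinate that was
   moved. *)
have back j k : set_coord (set_coord x j (tnth x j + phi j k x)) j
    (tnth (set_coord x j (tnth x j + phi j k x)) j -
     phi j k (set_coord x j (tnth x j + phi j k x))) = x.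
  apply: eq_from_tnth => i; rewrite phij /set_coord !tnth_mktuple eqxx.
  by case: eqP => // ->; rewrite addrK.
have [Xx|Xx] := pselect (X x); last first.
  rewrite patchE memNset// big1// => j _; rewrite eseries0// => k _ _.
  by rewrite /F' /F back (indicE _ X) memNset// mulr0.
rewrite patchE mem_set// wD; last exact: XD.
rewrite -transfer//; last exact: XD.
apply: eq_bigr => j _; apply: eq_eseriesr => k _.
rewrite /F' /F back (indicE _ X) mem_set// mulr1 mulrC; congr (_%:E).
rewrite !indicE; case: (boolP (_ \in _)); last by rewrite !mul0r.
by rewrite inE => /BD /wD ->.
Qed.

End invariance.

(** * Extremal coordinates *)

Lemma measurable_bigmaxr (R : realType) dT (T : measurableType dT) I (r : seq I)
    (P : pred I) (f : I -> T -> R) (g : T -> R) :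
  (forall i, measurable_fun setT (f i)) -> measurable_fun setT g ->
  measurable_fun setT (fun x => \big[Num.max/g x]_(i <- r | P i) f i x).
Proof.
move=> mf mg; elim: r => [|i r IH]; first by under eq_fun do rewrite big_nil.
under eq_fun do rewrite big_cons; case: (P i) => //.
exact: measurable_maxr.
Qed.

Lemma measurable_bigminr (R : realType) dT (T : measurableType dT) I (r : seq I)
    (P : pred I) (f : I -> T -> R) (g : T -> R) :
  (forall i, measurable_fun setT (f i)) -> measurable_fun setT g ->
  measurable_fun setT (fun x => \big[Num.min/g x]_(i <- r | P i) f i x).
Proof.
move=> mf mg; elim: r => [|i r IH]; first by under eq_fun do rewrite big_nil.
under eq_fun do rewrite big_cons; case: (P i) => //.
exact: measurable_minr.
Qed.

Section coordinates.
Context (R : realType) (d : nat).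
Implicit Types (s : {perm 'I_d.+1}) (x : d.+1.-tuple R) (P : pred 'I_d.+1).

(* Meaningful when [P] is not empty and the coordinates are nonnegative. *)
Definition max_on P x := \big[Num.max/0]_(i | P i) tnth x i.
Definition min_on P x := \big[Num.min/max_on P x]_(i | P i) tnth x i.

Lemma measurable_max_on P : measurable_fun setT (max_on P).
Proof. by apply: measurable_bigmaxr => // i; exact: measurable_tnth. Qed.

Lemma measurable_min_on P : measurable_fun setT (min_on P).
Proof.
apply: measurable_bigminr => [i|]; first exact: measurable_tnth.
exact: measurable_max_on.
Qed.

Lemma le_max_on P x i : P i -> tnth x i <= max_on P x.
Proof. by move=> Pi; exact: (@le_bigmax_cond _ _ _ _ i P (tnth x)). Qed.

Lemma min_on_le P x i : P i -> min_on P x <= tnth x i.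
Proof. by move=> Pi; exact: (@bigmin_le_cond _ _ _ _ i P (tnth x)). Qed.

Lemma max_on_eq P x i : P i -> 0 <= tnth x i ->
  (forall k, P k -> tnth x k <= tnth x i) -> max_on P x = tnth x i.
Proof.
by move=> Pi x0 xi; apply/eqP; rewrite eq_le le_max_on// andbT bigmax_le.
Qed.

(** The default value [max_on P x] of the fold is at least every selected coordinate, so it never
    lowers the minimum. The default 0 of [max_on] is why [max_on_eq] asks for a sign. *)
Lemma min_on_eq P x i : P i ->
  (forall k, P k -> tnth x i <= tnth x k) -> min_on P x = tnth x i.
Proof.
move=> Pi xi; apply/eqP; rewrite eq_le min_on_le//= le_bigmin//.
exact: le_max_on.
Qed.

Lemma max_on_ge0 P x : orthant x -> 0 <= max_on P x.
Proof. by move=> x0; apply: bigmax_ge_id. Qed.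

Lemma min_on_ge0 P x : orthant x -> 0 <= min_on P x.
Proof. by move=> x0; rewrite le_bigmin ?max_on_ge0// => i _; exact/ltW/x0. Qed.

Lemma max_on_gt0 P x i : orthant x -> P i -> 0 < max_on P x.
Proof. by move=> x0 Pi; apply: lt_le_trans (le_max_on x Pi); exact: x0. Qed.

Lemma min_on_gt0 P x i : orthant x -> P i -> 0 < min_on P x.
Proof. by move=> x0 Pi; rewrite lt_bigmin ?(max_on_gt0 x0 Pi). Qed.

Lemma tnth_set_coord x j a i :
  tnth (set_coord x j a) i = if i == j then a else tnth x i.
Proof. by rewrite /set_coord tnth_mktuple. Qed.

(** With its analogue for the minimum, this makes the displacements of both maps independent of the
    moved coordinate, as shears require. *)
Lemma max_others_set_coord x j a :
  max_on (predC1 j) (set_coord x j a) = max_on (predC1 j) x.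
Proof.
by apply: eq_bigr => i /= /negbTE ij; rewrite tnth_set_coord ij.
Qed.

Lemma min_others_set_coord x j a :
  min_on (predC1 j) (set_coord x j a) = min_on (predC1 j) x.
Proof.
rewrite /min_on max_others_set_coord.
by apply: eq_bigr => i /= /negbTE ij; rewrite tnth_set_coord ij.
Qed.

Lemma prod_set_coord x j a :
  \prod_i tnth (set_coord x j a) i = a * \prod_(i | i != j) tnth x i.
Proof.
rewrite (bigD1 j)//= tnth_set_coord eqxx; congr (_ * _).
by apply: eq_bigr => i /= /negbTE ij; rewrite tnth_set_coord ij.
Qed.

Lemma orthant_set_coord x j a : orthant x -> 0 < a -> orthant (set_coord x j a).
Proof. by move=> x0 a0 i; rewrite tnth_set_coord; case: ifP => // _; exact: x0. Qed.

Lemma chamber_orthant s x : chamber s x -> orthant x.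
Proof. by move=> /andP[/forallP]. Qed.

Lemma chamber_lt s x (i j : 'I_d.+1) : chamber s x -> (i < j)%N ->
  tnth x (s j) < tnth x (s i).
Proof. by move=> /andP[_ /forallP/(_ i)/forallP/(_ j)/implyP]; exact. Qed.

Lemma chamber_le s x (i j : 'I_d.+1) : chamber s x -> (i <= j)%N ->
  tnth x (s j) <= tnth x (s i).
Proof.
move=> sx; rewrite leq_eqVlt => /orP[/eqP/val_inj ->//|ij].
exact/ltW/(chamber_lt sx).
Qed.

(** Inside the orthant this is exactly the complement of the union of the chambers. *)
Definition ties : set (d.+1.-tuple R) :=
  [set x | exists i j, i != j /\ tnth x i = tnth x j].

Lemma chamber_no_tie s x : chamber s x -> ~ ties x.
Proof.
move=> sx [i [j [+ ]]]; rewrite -(permKV s i) -(permKV s j).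
rewrite (inj_eq perm_inj) neq_ltn => /orP[] /(chamber_lt sx) + xij.
  by rewrite xij ltxx.
by rewrite xij ltxx.
Qed.

(** The permutation sends a rank to the index found there after sorting the indices by decreasing
    coordinate; absence of ties makes the order strict. *)
Lemma exists_chamber x : orthant x -> ~ ties x -> exists s, chamber s x.
Proof.
move=> x0 xt; pose r : rel 'I_d.+1 := fun i j => tnth x j <= tnth x i.
pose l := sort r (enum 'I_d.+1).
have sl : size l = d.+1 by rewrite size_sort size_enum_ord.
have ul : uniq l by rewrite sort_uniq enum_uniq.
have rl : sorted r l by apply: sort_sorted => i j; exact: le_total.
pose f (i : 'I_d.+1) := nth ord0 l i.
have fi : injective f.
  move=> i j /eqP; rewrite /f nth_uniq ?sl// => /eqP; exact: val_inj.
exists (perm fi); apply/andP; split; first exact/forallP.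
apply/forallP => i; apply/forallP => j; apply/implyP => ij; rewrite !permE.
rewrite lt_neqAle; apply/andP; split.
  apply/eqP => xij; apply: xt; exists (f j), (f i); split => //.
  by rewrite (inj_eq fi) neq_ltn ij orbT.
have rtr : transitive r by move=> a b c ab bc; exact: le_trans bc ab.
by apply: (sorted_ltn_nth rtr ord0 rl) => //; rewrite inE sl.
Qed.

Section in_chamber.
Context s x (sx : chamber s x) (d_gt0 : (0 < d)%N).

Let le_first k : tnth x k <= tnth x (s ord0).
Proof. by rewrite -(permKV s k) (chamber_le sx). Qed.

Let last_le k : tnth x (s ord_max) <= tnth x k.
Proof. by rewrite -[in leRHS](permKV s k) (chamber_le sx)// -ltnS. Qed.

Lemma inord1K : nat_of_ord (inord 1 : 'I_d.+1) = 1%N.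
Proof. by rewrite inordK. Qed.

Lemma chamber_max : max_on predT x = tnth x (s ord0).
Proof. by apply: max_on_eq => //; apply/ltW/(chamber_orthant sx). Qed.

Lemma chamber_min : min_on predT x = tnth x (s ord_max).
Proof. exact: min_on_eq. Qed.

Lemma chamber_max_others : max_on (predC1 (s ord0)) x = tnth x (s (inord 1)).
Proof.
apply: max_on_eq => /=; last 2 first.
- exact/ltW/(chamber_orthant sx).
- move=> k; rewrite -{1 2}(permKV s k) (inj_eq perm_inj) => k0.
  by rewrite (chamber_le sx)// inord1K lt0n.
by rewrite (inj_eq perm_inj) -val_eqE/= inord1K.
Qed.

Lemma chamber_min_others : min_on (predC1 (s ord0)) x = tnth x (s ord_max).
Proof.
apply: min_on_eq => //=.
by rewrite (inj_eq perm_inj) -val_eqE/= -lt0n.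
Qed.

Lemma chamber_max_others_last :
  max_on (predC1 (s ord_max)) x = tnth x (s ord0).
Proof.
apply: max_on_eq => //=; last exact/ltW/(chamber_orthant sx).
by rewrite (inj_eq perm_inj) -val_eqE/= eq_sym -lt0n.
Qed.

(** Recognizes the index of the largest coordinate without the permutation: for any other [j], the
    largest coordinate is among those bounded by [M_j]. *)
Lemma chamber_max_others_le j : (max_on (predC1 j) x <= tnth x j) = (j == s ord0).
Proof.
have [->|js] := eqVneq j (s ord0).
  by rewrite bigmax_le// ltW// (chamber_orthant sx).
apply/negbTE; rewrite -ltNge; apply: (@lt_le_trans _ _ (tnth x (s ord0))).
  rewrite -(permKV s j) (chamber_lt sx)// lt0n; apply: contra_neq js => j0.
  by rewrite -(permKV s j); congr (s _); exact: val_inj.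
by apply: le_max_on; rewrite /= eq_sym.
Qed.

(** The counterpart for the smallest coordinate; it selects the index at which preimages are formed
    by adding at least [M_j]. *)
Lemma chamber_lt_min_others j : (tnth x j < min_on (predC1 j) x) = (j == s ord_max).
Proof.
have lastlt k : k != s ord_max -> tnth x (s ord_max) < tnth x k.
  move=> ks; rewrite -[in ltRHS](permKV s k) (chamber_lt sx)//.
  rewrite ltn_neqAle -ltnS ltn_ord andbT; apply: contra_neq ks => kd.
  by rewrite -(permKV s k); congr (s _); exact: val_inj.
have [->|js] := eqVneq j (s ord_max).
  (* The default value of the minimum must also be exceeded; it is the largest coordinate, at a
     different index since [0 < d]. *)
  rewrite lt_bigmin// chamber_max_others_last (chamber_lt sx)//.
apply/negbTE; rewrite -leNgt; apply: (@le_trans _ _ (tnth x (s ord_max))).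
  by apply: min_on_le; rewrite /= eq_sym.
exact/ltW/lastlt.
Qed.

End in_chamber.

End coordinates.

(** * Branches of the two maps *)

Lemma measurable_fun_countable_cover dT1 dT2 (T1 : measurableType dT1)
    (T2 : measurableType dT2) (I : countType) (E : I -> set T1) (D : set T1)
    (f : T1 -> T2) :
  (forall i, measurable (E i)) -> D = \bigcup_i E i ->
  (forall i, measurable_fun (E i) f) -> measurable_fun D f.
Proof.
move=> mE -> mf _ Y mY; rewrite setI_bigcupl.
by apply: countable_bigcupT_measurable => // i; exact: mf.
Qed.

Lemma negligible_countable_bigcup dT (T : measurableType dT) (R : realType)
    (mu : {measure set T -> \bar R}) (I : countType) (E : I -> set T) :
  (forall i, mu.-negligible (E i)) -> mu.-negligible (\bigcup_i E i).
Proof.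
move=> nE; pose F n := if unpickle n is Some i then E i else set0.
apply: (@negligibleS _ _ _ _ (\bigcup_n F n)).
  by move=> x [i _ Eix]; exists (pickle i) => //; rewrite /F pickleK.
apply: negligible_bigcup => n; rewrite /F; case: unpickle => [i|] //.
exact: negligible_set0.
Qed.

Section triangle_maps.
Context (R : realType) (d : nat) (d_gt0 : (0 < d)%N).
Implicit Types (s : {perm 'I_d.+1}) (x : d.+1.-tuple R) (j : 'I_d.+1).

Local Notation D := (@orthant R d.+1).
Local Notation M j := (max_on (predC1 j)).
Local Notation m j := (min_on (predC1 j)).
Local Notation ties := (@ties R d).

Lemma tiesE : ties =
  \bigcup_(p : 'I_d.+1 * 'I_d.+1)
    (if p.1 == p.2 then set0 else [set x | tnth x p.1 = tnth x p.2]).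
Proof.
apply/seteqP; split => [x [i [j [ij xij]]]|x [[i j] _]/=].
  by exists (i, j) => //=; rewrite (negbTE ij).
by case: eqVneq => // ij xij; exists i, j.
Qed.

Lemma measurable_ties : measurable ties.
Proof.
rewrite tiesE; apply: countable_bigcupT_measurable => // -[i j] /=.
case: ifP => // _.
rewrite (_ : [set _ | _] = (fun x => tnth x i == tnth x j) @^-1` [set true]).
  rewrite -[X in measurable X]setTI.
  by apply: measurable_fun_eqr => //; exact: measurable_tnth.
by apply/seteqP; split => x /= /eqP.
Qed.

(** For [i != j], the tie between coordinates [i] and [j] is a graph over the coordinates other than
    [i]. *)
Lemma negligible_ties : (lebesgue_tuple R d.+1).-negligible ties.
Proof.
rewrite tiesE; apply: negligible_countable_bigcup => -[i j] /=.
case: eqVneq => [_|ij]; first exact: negligible_set0.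
apply: (@lebesgue_tuple_graph _ _ i (fun x => tnth x j)).
  exact: measurable_tnth.
by move=> x a; rewrite tnth_set_coord eq_sym (negbTE ij).
Qed.

(** The union of the chambers whose largest coordinate has index [j], described through [M_j] so
    that no permutation occurs. *)
Definition leading j : set (d.+1.-tuple R) :=
  (D `\` ties) `&` [set x | M j x <= tnth x j].

Lemma measurable_leading j : measurable (leading j).
Proof.
apply: measurableI.
  by apply: measurableD; [exact: measurable_orthant|exact: measurable_ties].
rewrite -[X in measurable X]setTI.
apply: (measurable_fun_ler (measurable_max_on _) (measurable_tnth _)) => //.
Qed.

Lemma leading_chamber j x : leading j x -> exists2 s, chamber s x & s ord0 = j.
Proof.
move=> [[Dx xt] /=] Mx; have [s sx] := exists_chamber Dx xt.
by exists s => //; apply/esym/eqP; rewrite -(chamber_max_others_le sx).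
Qed.

(** The sets [leading j] and the tied points, indexed by [None], cover the orthant; on the latter
    [S] is the identity. *)
Lemma measurable_fun_leading (S : d.+1.-tuple R -> d.+1.-tuple R) :
  (forall x, ties x -> S x = x) ->
  (forall j, measurable_fun (leading j) S) -> measurable_fun D S.
Proof.
move=> St Sl; pose E (o : option 'I_d.+1) :=
  if o is Some j then leading j else D `&` ties.
have mDt : measurable (D `&` ties).
  by apply: measurableI; [exact: measurable_orthant|exact: measurable_ties].
apply: (@measurable_fun_countable_cover _ _ _ _ _ E).
- by case=> [j|] //; exact: measurable_leading.
- apply/seteqP; split => [x Dx|x [i _]].
    have [xt|xt] := pselect (ties x); first by exists None.
    have [s sx] := exists_chamber Dx xt; exists (Some (s ord0)) => //=.
    by split => //=; rewrite (chamber_max_others_le sx).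
  by case: i => [j [[]]|[]].
case=> [j|] //=; apply: (@eq_measurable_fun _ _ _ _ _ id) => //.
by move=> x; rewrite inE => -[_ xt]; rewrite St.
Qed.

Lemma slow_triangle_ties x : ties x -> slow_triangle x = x.
Proof.
by move=> xt; rewrite /slow_triangle; case: pickP => // s /chamber_no_tie.
Qed.

Lemma acc_triangle_ties x : ties x -> acc_triangle x = x.
Proof.
by move=> xt; rewrite /acc_triangle; case: pickP => // s /chamber_no_tie.
Qed.

Lemma slow_triangle_leading j x : leading j x ->
  slow_triangle x = set_coord x j
    (if tnth x j < M j x + m j x then tnth x j - M j x else tnth x j - m j x).
Proof.
move=> /leading_chamber[s sx <-]; rewrite (slow_triangleE sx) /slow_step.
by rewrite (chamber_max_others sx)// (chamber_min_others sx).
Qed.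

(** On [leading j] this is the condition defining the integer [k] of the accelerated map. *)
Definition between j x k :=
  M j x + k%:R * m j x < tnth x j < M j x + k.+1%:R * m j x.

Lemma acc_triangle_leading j x : leading j x ->
  acc_triangle x = set_coord x j
    (tnth x j - M j x - (xget 0%N [set k | between j x k])%:R * m j x).
Proof.
move=> /leading_chamber[s sx <-]; rewrite (acc_triangleE sx) /acc_step.
by rewrite /between (chamber_max_others sx)// (chamber_min_others sx).
Qed.

Lemma set_fun_slow_triangle : set_fun D D (@slow_triangle R d).
Proof.
move=> x Dx; have [xt|xt] := pselect (ties x).
  by rewrite slow_triangle_ties.
have [s sx] := exists_chamber Dx xt.
rewrite (slow_triangleE sx); apply: orthant_set_coord => //.
rewrite /slow_step; case: ifPn => [_|].
  by rewrite subr_gt0 (chamber_lt sx)// inord1K.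
rewrite -leNgt -lerBrDr; apply: lt_le_trans; exact: Dx.
Qed.

Lemma set_fun_acc_triangle : set_fun D D (@acc_triangle R d).
Proof.
move=> x Dx; have [xt|xt] := pselect (ties x).
  by rewrite acc_triangle_ties.
have [s sx] := exists_chamber Dx xt.
rewrite (acc_triangleE sx); apply: orthant_set_coord => //.
rewrite /acc_step -addrA -opprD subr_gt0.
case: xgetP => [k _ /andP[]//|_].
(* Without an admissible integer the default 0 is used, and the new coordinate is the gap between
   the two largest ones. *)
by rewrite mul0r addr0 (chamber_lt sx)// inord1K.
Qed.

(** Each lower endpoint lies below the upper endpoint of the other interval, which gives both
    [k <= k'] and [k' <= k]. *)
Lemma between_inj j x k k' : 0 < m j x ->
  between j x k -> between j x k' -> k = k'.
Proof.
move=> m0 /andP[k1 k2] /andP[k'1 k'2].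
have le (a b : nat) : M j x + a%:R * m j x < M j x + b.+1%:R * m j x -> (a <= b)%N.
  by rewrite ltrD2l ltr_pM2r// ltr_nat.
by apply/eqP; rewrite eqn_leq (le _ _ (lt_trans k1 k'2)) (le _ _ (lt_trans k'1 k2)).
Qed.

(** The integer is the integer part of [(x_j - M_j) / m_j]; the last hypothesis makes the lower
    inequality strict. *)
Lemma exists_between j x : 0 < m j x -> M j x <= tnth x j ->
  (forall k, tnth x j <> M j x + k%:R * m j x) -> exists k, between j x k.
Proof.
move=> m0 Mx xk; pose r := (tnth x j - M j x) / m j x.
have r0 : 0 <= r by rewrite divr_ge0 ?subr_ge0// ltW.
have /andP[k1 k2] := truncn_itv r0; exists (Num.truncn r); apply/andP; split.
  rewrite lt_neqAle; apply/andP; split; first by apply/eqP => /esym; exact: xk.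
  by rewrite addrC -lerBrDr -ler_pdivlMr.
by rewrite addrC -ltrBlDr -ltr_pdivrMr.
Qed.

Lemma measurable_between j k : measurable [set x | between j x k].
Proof.
have mM := measurable_max_on (R := R) (predC1 j).
have mm := measurable_min_on (R := R) (predC1 j).
have mMm c : measurable_fun setT (fun x => M j x + c * m j x).
  by apply: measurable_funD => //; apply: measurable_funM.
rewrite (_ : [set _ | _] =
  [set x | M j x + k%:R * m j x < tnth x j] `&`
  [set x | tnth x j < M j x + k.+1%:R * m j x]); last first.
  by apply/seteqP; split => [x /andP[]//|x [? ?]]; exact/andP.
apply: measurableI; rewrite -[X in measurable X]setTI.
  by apply: (measurable_fun_ltr (mMm _) (measurable_tnth j)).
by apply: (measurable_fun_ltr (measurable_tnth j) (mMm _)).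
Qed.

Lemma measurable_slow_triangle : measurable_fun D (@slow_triangle R d).
Proof.
apply: measurable_fun_leading; first exact: slow_triangle_ties.
move=> j; pose f x := if tnth x j < M j x + m j x
  then tnth x j - M j x else tnth x j - m j x.
apply: (@eq_measurable_fun _ _ _ _ _ (fun x => set_coord x j (f x))).
  by move=> x; rewrite inE => /slow_triangle_leading ->.
apply: measurable_funTS; apply: measurable_set_coord.
have mM := measurable_max_on (R := R) (predC1 j).
have mm := measurable_min_on (R := R) (predC1 j).
have mt := @measurable_tnth _ (measurableTypeR R) _ j.
have mlt : measurable_fun setT (fun x => tnth x j < M j x + m j x).
  by apply: measurable_fun_ltr => //; exact: measurable_funD.
by apply: (measurable_fun_ifT mlt); exact: measurable_funB.
Qed.

Lemma leading_min_gt0 j x : leading j x -> 0 < m j x.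
Proof.
move=> /leading_chamber[s sx <-].
by rewrite (chamber_min_others sx)//; exact: (chamber_orthant sx).
Qed.

Lemma measurable_acc_triangle : measurable_fun D (@acc_triangle R d).
Proof.
apply: measurable_fun_leading; first exact: acc_triangle_ties.
(* [leading j] is cut into the pieces where the integer is a given [k] and a remainder, [None],
   where [xget] returns its default 0. On each piece the map is a single shear. *)
move=> j; pose E (o : option nat) := if o is Some k
  then leading j `&` [set x | between j x k]
  else leading j `\` \bigcup_k [set x | between j x k].
have mM := measurable_max_on (R := R) (predC1 j).
have mm := measurable_min_on (R := R) (predC1 j).
have mt := @measurable_tnth _ (measurableTypeR R) _ j.
apply: (@measurable_fun_countable_cover _ _ _ _ _ E).
- case=> [k|] /=.
    by apply: measurableI; [exact: measurable_leading|exact: measurable_between].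
  apply: measurableD; first exact: measurable_leading.
  by apply: bigcupT_measurable => k; exact: measurable_between.
- apply/seteqP; split => [x jx|x [[k|] _ []]//].
  have [[k _ xk]|xN] := pselect ((\bigcup_k [set x | between j x k]) x).
    by exists (Some k).
  by exists None.
move=> o; pose k := if o is Some k then k else 0%N.
apply: (@eq_measurable_fun _ _ _ _ _ (fun x =>
    set_coord x j (tnth x j - M j x - k%:R * m j x))).
  move=> x; rewrite inE => Ex.
  have jx : leading j x by case: o Ex {k} => [?|] [].
  rewrite (acc_triangle_leading jx); congr (set_coord _ _ (_ - _%:R * _)).
  rewrite /k; case: o Ex {k} => [k|] [_ /= xk].
    apply/esym/xget_unique => // k' xk'.
    exact: between_inj (leading_min_gt0 jx) xk' xk.
  by apply/esym; case: xgetP => // k _ xk'; case: xk; exists k.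
apply: measurable_funTS; apply: measurable_set_coord; apply: measurable_funB.
  exact: measurable_funB.
exact: measurable_funM.
Qed.

End triangle_maps.

(** * Transfer equations *)

Lemma measurable_fun_inv_gt0 dT (T : measurableType dT) (R : realType)
    (D : set T) (f : T -> R) :
  measurable_fun D f -> (forall x, D x -> 0 < f x) ->
  measurable_fun D (fun x => (f x)^-1).
Proof.
move=> mf f0; apply: (@eq_measurable_fun _ _ _ _ _ (fun x => f x `^ (-1))).
  by move=> x; rewrite inE => /f0 fx; rewrite powR_inv1// ltW.
by apply: (@measurableT_comp _ _ _ _ _ _ (@powR R ^~ (-1))).
Qed.

Section series.
Context (R : realType).

Lemma nneseries_first2 (u : nat -> \bar R) :
  (forall k, 0 <= u k)%E -> (forall k, u k.+2 = 0%E) ->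
  (\sum_(0 <= k <oo) u k = u 0%N + u 1%N)%E.
Proof.
move=> u0 u2; rewrite (@nneseries_split _ _ 0%N 2%N)//.
rewrite eseries0 ?adde0; first by rewrite big_nat_recr//= big_nat1.
by move=> [|[|k]] //.
Qed.

Lemma eseries_telescope (v : nat -> R) : v k @[k --> \oo] --> 0 ->
  (\sum_(0 <= k <oo) (v k - v k.+1)%:E = (v 0%N)%:E)%E.
Proof.
move=> v0; apply/cvg_lim => //.
rewrite (_ : (fun n => _) = (fun n => (v 0%N - v n)%:E)); last first.
  apply/funext => n; rewrite sumEFin; congr (_%:E).
  apply: oppr_inj; rewrite opprB -(telescope_sumr v (leq0n n)) -sumrN.
  by apply: eq_bigr => k _; rewrite opprB.
apply: cvg_EFin; first by apply: nearW.
rewrite -[X in _ --> X]subr0.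
by apply: cvgB => //; exact: cvg_cst.
Qed.

Lemma cvg_arith_inv0 (c r : R) : 0 < c -> 0 < r ->
  (c + k%:R * r)^-1 @[k --> \oo] --> 0.
Proof.
move=> c0 r0; apply/gtr0_cvgV0.
  by apply: nearW => k; rewrite ltr_wpDr// mulr_ge0// ltW.
(* From this rank on, [k] exceeds [A / r], so [k%:R * r] alone is at least [A]. *)
apply/cvgryPge => A; exists (Num.truncn (A / r)).+1 => // k /= Ak.
apply: (@le_trans _ _ (k%:R * r)); last by rewrite lerDr ltW.
rewrite -ler_pdivrMr//; apply/ltW/(lt_le_trans (truncnS_gt _)).
by rewrite ler_nat.
Qed.

End series.

Section transfer.
Context (R : realType) (d : nat) (d_gt0 : (0 < d)%N).
Implicit Types (s : {perm 'I_d.+1}) (x : d.+1.-tuple R) (j : 'I_d.+1).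

Local Notation D := (@orthant R d.+1).
Local Notation M j := (max_on (predC1 j)).
Local Notation m j := (min_on (predC1 j)).
Local Notation ties := (@ties R d).

Lemma prod_gt0 P x : orthant x -> 0 < \prod_(i < d.+1 | P i) tnth x i.
Proof. by move=> x0; apply: prodr_gt0. Qed.

Lemma first_neq_last s : s ord0 != s ord_max.
Proof. by rewrite (inj_eq perm_inj) -val_eqE/= eq_sym -lt0n. Qed.

(** * Density, branches and transfer equation of the slow map *)

Definition slow_density x := 1 / \prod_(i < d.+1) tnth x i.

(** Branch 0 subtracts [M_j] and branch 1 subtracts [m_j]; higher indices are empty padding, as the
    general criterion indexes branches by [nat]. The wall between them goes to branch 1, as in
    [slow_step]. *)
Definition slow_branch j (k : nat) : set (d.+1.-tuple R) :=
  D `&` [set x | match k with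
                 | 0 => M j x < tnth x j < M j x + m j x
                 | 1 => M j x + m j x <= tnth x j
                 | _ => False
                 end].

Definition slow_shift j (k : nat) x := if k == 0%N then M j x else m j x.

Lemma slow_transfer x : orthant x -> ~ ties x ->
  (\sum_(j < d.+1) \sum_(0 <= k <oo)
     (let x' := set_coord x j (tnth x j + slow_shift j k x)%R in
      (\1_(slow_branch j k) x' * slow_density x')%:E) = (slow_density x)%:E)%E.
Proof.
move=> Dx xt; have [s sx] := exists_chamber Dx xt.
set a := s ord_max; set b := s ord0.
have ba : b != a by exact: first_neq_last.
pose y j c := set_coord x j (tnth x j + c).
have Dy j c : 0 <= c -> orthant (y j c).
  by move=> c0; apply: orthant_set_coord => //; rewrite ltr_wpDr//; exact: Dx.
have M0 j := max_on_ge0 (predC1 j) Dx; have m0 j := min_on_ge0 (predC1 j) Dx.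
(* The upper bound of branch 0 becomes [x_j < m_j] after adding [M_j], so only the smallest
   coordinate qualifies. *)
have B0 j : \1_(slow_branch j 0) (y j (M j x)) = (j == a)%:R :> R.
  rewrite indicE; congr (nat_of_bool _)%:R.
  rewrite -(chamber_lt_min_others sx d_gt0); apply/idP/idP.
    rewrite inE => -[_ /= /andP[_]].
    rewrite max_others_set_coord min_others_set_coord tnth_set_coord eqxx.
    by rewrite addrC ltrD2l.
  move=> xm; rewrite inE; split; [exact: Dy|apply/andP].
  rewrite max_others_set_coord min_others_set_coord tnth_set_coord eqxx.
  by rewrite addrC ltrDl ltrD2l Dx.
(* The inequality of branch 1 becomes [M_j <= x_j] after adding [m_j], so only the largest
   coordinate qualifies. *)
have B1 j : \1_(slow_branch j 1) (y j (m j x)) = (j == b)%:R :> R.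
  rewrite indicE; congr (nat_of_bool _)%:R.
  rewrite -(chamber_max_others_le sx); apply/idP/idP.
    rewrite inE => -[_ /=].
    rewrite max_others_set_coord min_others_set_coord tnth_set_coord eqxx.
    by rewrite lerD2r.
  move=> xm; rewrite inE; split; first exact: Dy.
  rewrite /= max_others_set_coord min_others_set_coord tnth_set_coord eqxx.
  by rewrite lerD2r.
transitivity (\sum_j (((j == a)%:R * slow_density (y j (M j x)))%:E +
                     ((j == b)%:R * slow_density (y j (m j x)))%:E))%E.
  apply: eq_bigr => j _; rewrite nneseries_first2/=; first by rewrite B0 B1.
  - move=> k; rewrite lee_fin mulr_ge0// divr_ge0// ltW// prod_gt0//.
    by apply: Dy; rewrite /slow_shift; case: ifP.
  - by move=> k; rewrite indicE memNset ?mul0r// => -[].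
have pick1 c (w : 'I_d.+1 -> R) : (\sum_j ((j == c)%:R * w j)%:E = (w c)%:E)%E.
  rewrite (bigD1 c)//= eqxx mul1r big1 ?adde0// => i /negbTE ->.
  by rewrite mul0r.
rewrite big_split/= !pick1.
rewrite -EFinD; congr (_%:E); rewrite /slow_density !prod_set_coord.
rewrite (chamber_max_others_last sx)// (chamber_min_others sx)// -/a -/b.
(* Both preimages have new coordinate [x_a + x_b], at index [a] or [b], and share the factor [Q]; a
   partial fraction identity remains. *)
pose Q := \prod_(i < d.+1 | (i != a) && (i != b)) tnth x i.
have Qa : \prod_(i | i != a) tnth x i = tnth x b * Q by rewrite (bigD1 b).
have Qb : \prod_(i | i != b) tnth x i = tnth x a * Q.
  rewrite (bigD1 a) 1?eq_sym//=; congr (_ * _).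
  by apply: eq_bigl => i; rewrite andbC.
rewrite [in RHS](bigD1 a)//= Qa Qb.
have Q0 : Q != 0 by rewrite gt_eqF// prod_gt0.
have a0 : tnth x a != 0 by rewrite gt_eqF// Dx.
have b0 : tnth x b != 0 by rewrite gt_eqF// Dx.
have ba0 : tnth x b + tnth x a != 0 by rewrite gt_eqF// addr_gt0// Dx.
by field; rewrite ba0 Q0 a0 b0.
Qed.

Lemma measurable_slow_branch j k : measurable (slow_branch j k).
Proof.
have mM := measurable_max_on (R := R) (predC1 j).
have mm := measurable_min_on (R := R) (predC1 j).
have mMm : measurable_fun setT (fun x => M j x + m j x) by exact: measurable_funD.
have mt := @measurable_tnth _ (measurableTypeR R) d.+1 j.
apply: measurableI; first exact: measurable_orthant.
case: k => [|[|k]]; last exact: measurable0.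
  rewrite (_ : [set _ | _] = [set x | M j x < tnth x j] `&`
      [set x | tnth x j < M j x + m j x]); last first.
    by apply/seteqP; split => [x /andP[]//|x [? ?]]; exact/andP.
  apply: measurableI; rewrite -[X in measurable X]setTI.
    by apply: (measurable_fun_ltr mM mt).
  by apply: (measurable_fun_ltr mt mMm).
rewrite -[X in measurable X]setTI.
by apply: (measurable_fun_ler mMm mt).
Qed.

Lemma slow_branchP x : orthant x -> ~ ties x -> exists j k,
  [/\ slow_branch j k x,
      slow_triangle x = set_coord x j (tnth x j - slow_shift j k x) &
      forall j' k', slow_branch j' k' x -> j' = j /\ k' = k].
Proof.
move=> Dx xt; have [s sx] := exists_chamber Dx xt; pose j := s ord0.
have jx : leading j x by split => //=; rewrite (chamber_max_others_le sx).
have Mj : M j x < tnth x j.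
  by rewrite (chamber_max_others sx)// (chamber_lt sx)// inord1K.
(* Every nonempty branch at [j'] forces [M_j' <= x_j'], hence [j'] is the index of the largest
   coordinate. *)
have j'E j' k' : slow_branch j' k' x -> j' = j.
  move=> [_ B]; apply/eqP; rewrite -(chamber_max_others_le sx).
  have m0 := min_on_ge0 (predC1 j') Dx.
  case: k' B => [/andP[/ltW]//|[|k' []]] /=; apply: le_trans.
  by rewrite lerDl.
have [lt|ge] := ltP (tnth x j) (M j x + m j x).
- exists j, 0%N; split.
  + by split => //=; rewrite Mj lt.
  + by rewrite (slow_triangle_leading d_gt0 jx) lt.
  + move=> j' k' B; have jj := j'E _ _ B; split => //; move: B; rewrite jj.
    by case: k' => [|[|k']] // -[_] //=; rewrite leNgt lt.
- exists j, 1%N; split.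
  + by split.
  + by rewrite (slow_triangle_leading d_gt0 jx) ltNge ge.
  + move=> j' k' B; have jj := j'E _ _ B; split => //; move: B; rewrite jj.
    by case: k' => [|[|k']] // -[_] //= /andP[_]; rewrite ltNge ge.
Qed.

(** * Density, branches and transfer equation of the accelerated map *)

(** One formula for all chambers: the numerator cancels the smallest factor of the product. It also
    fixes values on the tied points. *)
Definition acc_density x :=
  min_on predT x /
  ((max_on predT x + min_on predT x) * \prod_(i < d.+1) tnth x i).

Lemma acc_density_den_gt0 x : orthant x ->
  0 < (max_on predT x + min_on predT x) * \prod_(i < d.+1) tnth x i.
Proof.
move=> x0; rewrite mulr_gt0 ?prod_gt0// addr_gt0//.
  exact: (max_on_gt0 (i := ord0)).
exact: (min_on_gt0 (i := ord0)).
Qed.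

Lemma acc_density_gt0 x : orthant x -> 0 < acc_density x.
Proof.
move=> x0; rewrite divr_gt0 ?acc_density_den_gt0//.
exact: (min_on_gt0 (i := ord0)).
Qed.

Lemma measurable_prod_tnth :
  measurable_fun setT (fun x : d.+1.-tuple R => \prod_(i < d.+1) tnth x i).
Proof. by apply: measurable_prod => i _; exact: measurable_tnth. Qed.

Lemma measurable_acc_density : measurable_fun D acc_density.
Proof.
apply: measurable_funM; first by apply: measurable_funTS; exact: measurable_min_on.
apply: measurable_fun_inv_gt0 acc_density_den_gt0.
apply: measurable_funTS; apply: measurable_funM measurable_prod_tnth.
by apply: measurable_funD; [exact: measurable_max_on|exact: measurable_min_on].
Qed.

Definition acc_branch j k : set (d.+1.-tuple R) := D `&` [set x | between j x k].

Definition acc_shift j (k : nat) x := M j x + k%:R * m j x.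

Lemma acc_density_chamber s x : chamber s x ->
  acc_density x = 1 / ((tnth x (s ord0) + tnth x (s ord_max)) *
                       \prod_(i < d) tnth x (s (widen_ord (leqnSn d) i))).
Proof.
move=> sx; have x0 := chamber_orthant sx.
rewrite /acc_density (chamber_max sx) (chamber_min sx).
rewrite (reindex_inj (@perm_inj _ s))/= big_ord_recr/=.
set Q := \prod_(i < d) _.
have Q0 : Q != 0 by rewrite gt_eqF// prodr_gt0.
have m0 : tnth x (s ord_max) != 0 by rewrite gt_eqF.
have Mm0 : tnth x (s ord0) + tnth x (s ord_max) != 0 by rewrite gt_eqF ?addr_gt0.
by field; rewrite ?m0 ?Q0 ?Mm0.
Qed.

(** Evaluates the density at a preimage without exhibiting its chamber. Dropping a largest
    coordinate keeps the minimum, because another index [i] remains. *)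
Lemma acc_density_leading x j i : orthant x -> i != j -> M j x <= tnth x j ->
  acc_density x = m j x / ((tnth x j + m j x) * \prod_(i < d.+1) tnth x i).
Proof.
move=> x0 ij Mx.
have xj k : tnth x k <= tnth x j.
  have [->//|kj] := eqVneq k j; apply: le_trans Mx; exact: le_max_on.
have maxE : max_on predT x = tnth x j by apply: max_on_eq => //; exact/ltW.
have mi : m j x <= tnth x i by exact: min_on_le.
have minE : min_on predT x = m j x.
  apply/eqP; rewrite eq_le; apply/andP; split.
    apply: le_bigmin => [|k _]; last exact: min_on_le.
    by apply: le_trans (min_on_le x (isT : predT i)) _; exact: le_max_on.
  apply: le_bigmin => [|k _]; first by rewrite maxE (le_trans mi).
  have [->|kj] := eqVneq k j; last exact: min_on_le.
  exact: le_trans mi _.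
by rewrite /acc_density maxE minE.
Qed.

Lemma acc_transfer x : orthant x -> ~ ties x ->
  (\sum_(j < d.+1) \sum_(0 <= k <oo)
     (let x' := set_coord x j (tnth x j + acc_shift j k x)%R in
      (\1_(acc_branch j k) x' * acc_density x')%:E) = (acc_density x)%:E)%E.
Proof.
move=> Dx xt; have [s sx] := exists_chamber Dx xt.
set a := s ord_max; set b := s ord0.
have ba : b != a by exact: first_neq_last.
have M0 j := max_on_ge0 (predC1 j) Dx; have m0 j := min_on_ge0 (predC1 j) Dx.
have shift0 j k : 0 <= acc_shift j k x by rewrite addr_ge0// mulr_ge0.
pose y j k := set_coord x j (tnth x j + acc_shift j k x).
have Dy j k : orthant (y j k).
  by apply: orthant_set_coord => //; rewrite ltr_wpDr//; exact: Dx.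
have By j k : \1_(acc_branch j k) (y j k) = (j == a)%:R :> R.
  rewrite indicE; congr (nat_of_bool _)%:R.
  (* Cancelling the shift leaves [0 < x_j < m_j], free of [k]: the smallest coordinate contributes
     for every [k], the others never. *)
  have Bm : between j (y j k) k = (tnth x j < m j x).
    rewrite /between max_others_set_coord min_others_set_coord tnth_set_coord.
    rewrite eqxx ltrDr Dx/= addrC -natr1 mulrDl mul1r addrA.
    by rewrite /acc_shift ltrD2l.
  rewrite -(chamber_lt_min_others sx d_gt0) -Bm; apply/idP/idP.
    by rewrite inE => -[].
  by move=> yB; rewrite inE.
rewrite (bigD1 a)//= [X in (_ + X)%E]big1 ?adde0; last first.
  move=> j ja; rewrite eseries0// => k _ _.
  by rewrite -/(y j k) By (negbTE ja) mul0r.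
pose Q := \prod_(i < d.+1 | i != a) tnth x i.
(* [t k] is the new coordinate of the [k]-th preimage, and [Q] collects its unchanged
   coordinates. *)
pose t (k : nat) := tnth x a + M a x + k%:R * m a x.
have ma : 0 < m a x by apply: (min_on_gt0 Dx ba).
have t0 k : 0 < t k.
  by rewrite /t -addrA ltr_wpDr ?shift0//; exact: Dx.
have Q0 : 0 < Q by exact: prod_gt0.
(* As [t k.+1 = t k + m_a], the [k]-th term [m_a / ((t k + m_a) * t k * Q)] equals
   [v k - v k.+1]. *)
pose v k := (t k)^-1 / Q.
rewrite (@eq_eseriesr _ _ (fun k => (v k - v k.+1)%:E)); last first.
  move=> k _; rewrite -/(y a k) By eqxx mul1r; congr (_%:E).
  rewrite (@acc_density_leading (y a k) a b)//; last first.
    rewrite max_others_set_coord tnth_set_coord eqxx addrCA lerDl.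
    by apply: addr_ge0; [exact/ltW/Dx|exact: mulr_ge0].
  rewrite min_others_set_coord prod_set_coord tnth_set_coord eqxx -/Q.
  rewrite (_ : tnth x a + acc_shift a k x = t k); last by rewrite /t addrA.
  have tS : t k.+1 = t k + m a x by rewrite /t -natr1 mulrDl mul1r addrA.
  have Q0' := lt0r_neq0 Q0; have tk0 := lt0r_neq0 (t0 k).
  have := lt0r_neq0 (t0 k.+1); rewrite /v tS => tS0.
  by field; rewrite ?Q0' ?tk0 ?tS0.
rewrite eseries_telescope; last first.
  rewrite -[X in _ --> X](mul0r Q^-1); apply: cvgMl.
  by apply: cvg_arith_inv0 => //; rewrite addr_gt0 ?(max_on_gt0 Dx ba).
congr (_%:E); rewrite /v /t mul0r addr0 (chamber_max_others_last sx)//.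
rewrite /acc_density (chamber_max sx) (chamber_min sx) -/a -/b.
rewrite [in RHS](bigD1 a)//= -/Q.
have a0 : tnth x a != 0 by rewrite gt_eqF// Dx.
have ba0 : tnth x b + tnth x a != 0 by rewrite gt_eqF// addr_gt0// Dx.
have Q0' := lt0r_neq0 Q0.
by field; rewrite ?Q0' ?a0 ?ba0 1?addrC ?ba0.
Qed.

(** Besides ties it contains the walls where [x_j] is exactly [M_j + k m_j], on which the leading
    coordinate admits no integer. *)
Definition acc_null : set (d.+1.-tuple R) :=
  ties `|` \bigcup_(p : 'I_d.+1 * nat)
    [set x | tnth x p.1 = acc_shift p.1 p.2 x].

Lemma measurable_acc_shift j k : measurable_fun setT (acc_shift j k).
Proof.
apply: measurable_funD; first exact: measurable_max_on.
by apply: measurable_funM => //; exact: measurable_min_on.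
Qed.

Lemma acc_shift_set_coord j k x c :
  acc_shift j k (set_coord x j c) = acc_shift j k x.
Proof. by rewrite /acc_shift max_others_set_coord min_others_set_coord. Qed.

Lemma negligible_acc_null : (lebesgue_tuple R d.+1).-negligible acc_null.
Proof.
apply: negligibleU; first exact: negligible_ties.
apply: negligible_countable_bigcup => -[j k] /=; apply: lebesgue_tuple_graph.
  exact: measurable_acc_shift.
exact: acc_shift_set_coord.
Qed.

Lemma acc_branchP x : orthant x -> ~ acc_null x -> exists j k,
  [/\ acc_branch j k x,
      acc_triangle x = set_coord x j (tnth x j - acc_shift j k x) &
      forall j' k', acc_branch j' k' x -> j' = j /\ k' = k].
Proof.
move=> Dx xN; have xt : ~ ties x by move=> xt; apply: xN; left.
have [s sx] := exists_chamber Dx xt; pose j := s ord0.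
have jx : leading j x by split => //=; rewrite (chamber_max_others_le sx).
have mj := leading_min_gt0 d_gt0 jx.
have [k xk] : exists k, between j x k.
  apply: exists_between => //; first by case: jx.
  by move=> k xk; apply: xN; right; exists (j, k).
exists j, k; split => //.
  rewrite (acc_triangle_leading d_gt0 jx) (@xget_unique _ _ _ k)//.
    by rewrite /acc_shift opprD addrA.
  by move=> k' xk'; exact: between_inj mj xk' xk.
move=> j' k' [_ /= xk'].
have jj : j' = j.
  apply/eqP; rewrite -(chamber_max_others_le sx).
  case/andP: xk' => /ltW + _; apply: le_trans.
  by rewrite lerDl mulr_ge0// min_on_ge0.
by split => //; apply: between_inj mj _ xk; rewrite -jj.
Qed.

End transfer.

(** * Both invariant measures, from the criterion for piecewise shears *)

Theorem proposition5p6 (R : realType) (d : nat) (d_ge1 : (1 <= d)%N) :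
  (exists mu : {measure set (d.+1.-tuple R) -> \bar R},
     [/\ mu `<< lebesgue_tuple R d.+1,
         has_density (@orthant R d.+1)
           (fun x => 1 / \prod_(i < d.+1) tnth x i) mu &
         invariant_under (@orthant R d.+1) (@slow_triangle R d) mu])
  /\
  (exists (h : d.+1.-tuple R -> R)
          (mu : {measure set (d.+1.-tuple R) -> \bar R}),
     [/\ forall (s : {perm 'I_d.+1}) (x : d.+1.-tuple R), chamber s x ->
           h x = 1 / ((tnth x (s ord0) + tnth x (s ord_max)) *
                      \prod_(i < d) tnth x (s (widen_ord (leqnSn d) i))),
         mu `<< lebesgue_tuple R d.+1,
         has_density (@orthant R d.+1) h mu &
         invariant_under (@orthant R d.+1) (@acc_triangle R d) mu]).
Proof.
have mM P := @measurable_max_on R d P; have mm P := @measurable_min_on R d P.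
split.
  apply: (exists_shear_invariant_density (B := @slow_branch R d)
    (phi := @slow_shift R d) (N := @ties R d)).
  - apply: measurable_funM => //; apply: measurable_fun_inv_gt0 => [|x Dx].
      by apply: measurable_funTS; exact: measurable_prod_tnth.
    exact: prod_gt0.
  - by move=> x x0; rewrite divr_gt0// prod_gt0.
  - exact: set_fun_slow_triangle.
  - exact: measurable_slow_triangle.
  - exact: measurable_slow_branch.
  - by move=> j k x [].
  - by move=> j [|k]; [exact: mM|exact: mm].
  - by move=> j [|k] x c; rewrite /slow_shift/= ?max_others_set_coord
      ?min_others_set_coord.
  - exact: negligible_ties.
  - exact: slow_branchP.
  - exact: slow_transfer.
have [|||||||||||mu [muL muh muS]] := @exists_shear_invariant_density R d
  (@acc_density R d) (@acc_triangle R d) (@acc_branch R d) (@acc_shift R d)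
  (@acc_null R d).
- exact: measurable_acc_density.
- exact: acc_density_gt0.
- exact: set_fun_acc_triangle.
- exact: measurable_acc_triangle.
- move=> j k; apply: measurableI; first exact: measurable_orthant.
  exact: measurable_between.
- by move=> j k x [].
- exact: measurable_acc_shift.
- exact: acc_shift_set_coord.
- exact: negligible_acc_null.
- exact: acc_branchP.
- by move=> x Dx xN; apply: acc_transfer => // xt; apply: xN; left.
exists (@acc_density R d), mu; split => // s x; exact: acc_density_chamber.
Qed.
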